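(* If a space $X$ has an H-closed $\pi$-base whose elements have compact boundaries, then $|X|\leq 2^{wL(X)\,t(X)\,\psi_c(X)}$.
   Context: All spaces are Hausdorff topological spaces. A space $Y$ is H-closed if it is Hausdorff and closed in every Hausdorff space in which it is embedded; equivalently, $Y$ is Hausdorff and every open cover $\mathcal{U}$ of $Y$ has a finite subfamily $\mathcal{V}\subseteq\mathcal{U}$ with $\overline{\bigcup\mathcal{V}}=Y$. A $\pi$-base of $X$ is a family $\mathcal{B}$ of non-empty open subsets of $X$ such that every non-empty open subset of $X$ contains a member of $\mathcal{B}$. The hypothesis means that there is a single $\pi$-base $\mathcal{B}$ of $X$ such that for every $B\in\mathcal{B}$ the closure $\overline{B}$ (as a subspace) is H-closed and the boundary $\overline{B}\setminus B$ is compact. The weak Lindelöf number $wL(X)$ is the least cardinal $\kappa$ such that every open cover $\mathcal{U}$ of $X$ has a subfamily $\mathcal{V}\subseteq\mathcal{U}$ with $|\mathcal{V}|\leq\kappa$ and $\overline{\bigcup\mathcal{V}}=X$. The tightness $t(X)$ is the least cardinal $\kappa$ such that whenever $x\in\overline{A}$, $A\subseteq X$, there is $B\subseteq A$ with $|B|\leq\kappa$ and $x\in\overline{B}$. The closed pseudocharacter $\psi_c(X)$ is the least cardinal $\kappa$ such that for every $x\in X$ there is a family $\mathcal{V}_x$ of open neighborhoods of $x$ with $|\mathcal{V}_x|\leq\kappa$ and $\bigcap\{\overline{V}:V\in\mathcal{V}_x\}=\{x\}$. *)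

(* Defs.v *)
From mathcomp Require Import all_boot all_order.
From mathcomp Require Import all_classical topology.

Set Implicit Arguments.
Unset Strict Implicit.
Unset Printing Implicit Defensive.

Local Open Scope classical_set_scope.
Local Open Scope card_scope.

(* A cardinal is represented by a type of that cardinality: kappa * lambda is
   the product type and 2 ^ kappa is the function type kappa -> bool. *)

Definition is_least_cardinal (P : Type -> Prop) (K : Type) : Prop :=
  P K /\ forall L : Type, P L -> [set: K] #<= [set: L].

Lemma least_of_family (I : Type) (F : I -> Type) (i0 : I) :
  exists i, forall j, [set: F i] #<= [set: F j].
Proof.
pose P (S : set (forall i, F i)) :=
  forall i f g, S f -> S g -> f i = g i -> f = g.
have [S [PS maxS]] : exists S, P S /\ forall B, S `<` B -> ~ P B.
  apply: Zorn_bigcup => G GP totG i f g [A GA Af] [B GB Bg].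
  by case: (totG A B GA GB) => sAB; [apply: (GP B GB) => //; exact: sAB
                                    |apply: (GP A GA) => //; exact: sAB].
have [i surj_i] : exists i, forall x : F i, exists2 f, S f & f i = x.
  apply: contrapT => /forallNP nosurj.
  have {}nosurj i : exists x : F i, forall f, S f -> f i <> x.
    apply: contrapT => /forallNP h; apply: (nosurj i) => x.
    apply: contrapT => nx; apply: (h x) => f Sf fx.
    by apply: nx; exists f.
  pose g i : F i := sval (cid (nosurj i)).
  have gP i f : S f -> f i <> g i := svalP (cid (nosurj i)) f.
  apply: (maxS (S `|` [set g])).
    split; first by left.
    by move=> /(_ g (or_intror erefl)) Sg; exact: (gP i0 g Sg).
  move=> i f h [Sf|->] [Sh|->] // fh.
  - exact: PS fh.
  - by case: (gP i f Sf).
  - by case: (gP i h Sh).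
exists i => j.
pose s x := cid2 (surj_i x).
have injs : injective (fun x : F i => s2val (s x) j).
  move=> x y exy; rewrite -(s2valP' (s x)) -(s2valP' (s y)).
  by rewrite (PS _ _ _ (s2valP (s x)) (s2valP (s y)) exy).
rewrite -(card_le_eql (inj_card_eq (A := setT) (in2W injs))).
exact: card_leT.
Qed.

Lemma exists_least_cardinal (P : Type -> Prop) :
  (exists K, P K) -> exists K, is_least_cardinal P K.
Proof.
move=> [K0 PK0].
pose Q (A : set K0) (L : Type) := P L /\ [set: L] #= A.
pose F (A : set K0) : Type :=
  match pselect (exists L, Q A L) with
  | left h => sval (cid h)
  | right _ => K0
  end.
have PF A : P (F A).
  by rewrite /F; case: pselect => // h; case: (svalP (cid h)).
have [A minA] := least_of_family F set0.
exists (F A); split=> // L PL.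
have leF M : P M -> [set: M] #<= [set: K0] -> [set: F A] #<= [set: M].
  move=> PM /card_subP[C CM _]; apply: card_le_trans (minA C) _.
  rewrite /F; case: pselect => [h|[]]; last by exists M; split=> //; exact/card_esym.
  have [_ hC] := svalP (cid h).
  by rewrite (card_le_eql hC) (card_le_eql CM) card_lexx.
have [[] /= h] := least_of_family (fun b : bool => if b then K0 else L) true.
  by apply: card_le_trans (h false); exact: leF.
exact: leF (h true).
Qed.

(* The value [void] is taken only when no cardinal satisfies [P]. *)
Definition least_cardinal (P : Type -> Prop) : Type :=
  match pselect (exists K, is_least_cardinal P K) with
  | left h => sval (cid h)
  | right _ => void
  end.

Lemma least_cardinalP (P : Type -> Prop) :
  (exists K, P K) -> is_least_cardinal P (least_cardinal P).
Proof.
move=> /exists_least_cardinal h; rewrite /least_cardinal.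
by case: pselect => // h'; exact: svalP (cid h').
Qed.

Definition wL_le (X : topologicalType) (K : Type) : Prop :=
  forall U : set (set X), U `<=` open -> \bigcup_(A in U) A = setT ->
  exists V : set (set X),
    [/\ V `<=` U, V #<= [set: K] & closure (\bigcup_(A in V) A) = setT].

Definition tightness_le (X : topologicalType) (K : Type) : Prop :=
  forall (A : set X) (x : X), closure A x ->
  exists B : set X, [/\ B `<=` A, B #<= [set: K] & closure B x].

Definition closed_pseudocharacter_le (X : topologicalType) (K : Type) : Prop :=
  forall x : X, exists V : set (set X),
    [/\ forall A, V A -> open A /\ A x,
        V #<= [set: K] & \bigcap_(A in V) closure A = [set x]].

Definition wL (X : topologicalType) : Type := least_cardinal (wL_le X).

Definition tightness (X : topologicalType) : Type :=
  least_cardinal (tightness_le X).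

Definition closed_pseudocharacter (X : topologicalType) : Type :=
  least_cardinal (closed_pseudocharacter_le X).

Lemma wLP (X : topologicalType) : is_least_cardinal (wL_le X) (wL X).
Proof.
apply: least_cardinalP; exists (set X) => U oU covU.
by exists U; split=> //; [exact: card_leT | rewrite covU closureT].
Qed.

Lemma tightnessP (X : topologicalType) :
  is_least_cardinal (tightness_le X) (tightness X).
Proof.
apply: least_cardinalP; exists X => A x Ax.
by exists A; split=> //; exact: card_leT.
Qed.

Lemma closed_pseudocharacterP (X : topologicalType) : hausdorff_space X ->
  is_least_cardinal (closed_pseudocharacter_le X) (closed_pseudocharacter X).
Proof.
move=> hX; apply: least_cardinalP; exists (set X) => x.
exists [set A | open A /\ A x]; split=> //; first exact: card_leT.
apply/seteqP; split=> [y yV|y -> A [_ Ax]]; last exact: subset_closure.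
apply/esym/hX => A B nA nB.
move: nA; rewrite nbhsE => -[O [oO Ox] OA].
have [z [Oz Bz]] := yV O (conj oO Ox) B nB.
by exists z; split; [exact: OA|].
Qed.

(* The topology of [Y] is the one induced by [f] from [Z]. *)
Definition embedding (Y Z : topologicalType) (f : Y -> Z) : Prop :=
  injective f /\
  forall U : set Y, open U <-> exists2 V : set Z, open V & f @^-1` V = U.

Definition H_closed (Y : topologicalType) : Prop :=
  hausdorff_space Y /\
  forall (Z : topologicalType) (f : Y -> Z),
    hausdorff_space Z -> embedding f -> closed (range f).

Definition pi_base (X : topologicalType) (B : set (set X)) : Prop :=
  (forall A, B A -> open A /\ A !=set0) /\
  (forall U : set X, open U -> U !=set0 -> exists2 A, B A & A `<=` U).

(* Main.v *)
From HB Require Import structures.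
Require Import Defs.
From mathcomp Require Import all_boot all_order.
From mathcomp Require Import all_classical topology.

(** Write [K] for the product of the three invariants, and suppose first that
    [K] is infinite, so that each invariant is at most [K] and
    [2 ^ K = (2 ^ K) ^ K].

    Every element [A] of the pi-base has a closure of size at most [2 ^ K]
    ([card_closure_le_power]).  This is the Dow-Porter bound for H-closed
    spaces.  H-closedness means that open filters have cluster points
    ([H_closed_cluster]), so an ultrafilter containing [A] and all dense open
    sets singles out one point: the only point all of whose open neighbourhoods
    belong to it.  The space of these ultrafilters is compact and is mapped onto
    the closure of [A], and the fibre over [x] is the set of ultrafilters that
    contain the [K] chosen neighbourhoods of [x], an intersection of [K] open
    sets.  A compact space splits into at most [2 ^ K] fibres of this kind
    ([card_range_le_power], in the manner of Arhangel'skii and Gryzlov).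

    Hence a closing-off argument may add whole elements of the pi-base at each
    step.  It yields a set [H] of size at most [2 ^ K] with two properties.  It
    contains every point determined by a [K]-by-[K] array of points of [H], so
    that [H] is closed, by tightness and closed pseudocharacter.  And whenever
    the union of [K] chosen neighbourhoods of points of [H] is not dense, [H]
    includes an element of the pi-base that is disjoint from it.

    Let [G] be the closure of the union of the elements of the pi-base included
    in [H]; then [G] is included in [H].  If [G] is not the whole space, compact
    boundaries give an element [C] of the pi-base whose closure misses [G]
    ([compact_boundary_shrink]), and H-closedness gives each point of [G] a
    chosen neighbourhood disjoint from [C] ([separate_from_closure]).  These
    neighbourhoods and the complement of [G] cover the space; by the weak
    Lindelof number, [K] of them have a dense union.  The neighbourhoods among
    those [K] sets miss [C], so their union is not dense, and [H], hence [G],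
    includes an element of the pi-base disjoint from it.  That element also
    misses the complement of [G], although it is open and nonempty: a
    contradiction.  It is essential here that [G] is the closure of an open set,
    since weak Lindelofness says nothing about the points of an arbitrary
    closed set.

    If [K] is finite and the space has two points, the closed pseudocharacter is
    finite, the space is discrete, and its size is its weak Lindelof number. *)

Set Implicit Arguments.
Unset Strict Implicit.
Unset Printing Implicit Defensive.

Local Open Scope classical_set_scope.
Local Open Scope card_scope.

(** * Cardinal arithmetic *)

Lemma card_le_injP (S T : Type) :
  ([set: S] #<= [set: T]) <-> exists f : S -> T, injective f.
Proof.
split=> [/card_leP[f]|[f injf]]; last first.
  rewrite -(card_le_eql (inj_card_eq (A := setT) (in2W injf))).
  exact: card_leT.
exists (fun x => val (f (to_setT x))) => x y /val_inj.
by move=> /(inj (f := f)) e; have := e (in_setT _) (in_setT _); case.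
Qed.

Lemma card_le_range (T U : Type) (e : T -> U) (A : set U) :
  A `<=` range e -> A #<= [set: T].
Proof. by move=> /subset_card_le /card_le_trans; apply; exact: card_image_le. Qed.

(** The point [u0] makes the enumeration total; for this reason its range is
    only required to include [A]. *)
Lemma card_le_rangeP (T U : Type) (u0 : U) (A : set U) : A #<= [set: T] ->
  exists e : T -> U, A `<=` range e.
Proof.
move=> /card_leP[f].
pose e t := if pselect (exists x : A, val (f x) = t) is left h
            then val (sval (cid h)) else u0.
exists e => x Ax; exists (val (f (SigSub (mem_set Ax)))) => //.
rewrite /e; case: pselect => [h|[]]; last by exists (SigSub (mem_set Ax)).
have /val_inj E := svalP (cid h).
by rewrite (inj (f := f) (in_setT _) (in_setT _) E).
Qed.

(** Comparability is the case of a two-element family in the existence of a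
    least cardinal. *)
Lemma card_total (S T : Type) (A : set S) (B : set T) : (A #<= B) \/ (B #<= A).
Proof.
pose F (b : bool) := if b then set_type A else set_type B.
have [[] /= h] := least_of_family F true.
  left; have := h false.
  by rewrite (card_le_eql (card_setT A)) (card_le_eqr (card_setT B)).
right; have := h true.
by rewrite (card_le_eqr (card_setT A)) (card_le_eql (card_setT B)).
Qed.

Lemma card_le_funP (S T : Type) (t0 : T) (A : set S) (B : set T) : A #<= B ->
  exists f : S -> T, (forall x, A x -> B (f x)) /\
    forall x y, A x -> A y -> f x = f y -> x = y.
Proof.
move: t0 B; elim/Ppointed: T => T; first by move=> t0; case: (no t0).
move=> _ B /pcard_leP[f]; exists f; split=> [x Ax|x y Ax Ay].
  exact: 'funS_f.
by apply: 'inj_f; rewrite inE.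
Qed.

(** An infinite type [M] satisfies [M * M <= M].  The set of triples [(a, b, c)]
    is the graph of an injective pairing [(a, b) |-> c] of a subset of [M] with
    itself; that subset is read off the diagonal.  By Zorn's lemma there is a
    maximal pairing extending one carried by a copy of [nat], and maximality
    forces its carrier to have the size of [M]. *)
Section InfiniteSquare.
Variable M : Type.
Implicit Types G : set (M * M * M).

Let field_of G : set M := [set a | exists c, G (a, a, c)].

Let pairing G :=
  [/\ forall a b c, G (a, b, c) ->
        [/\ field_of G a, field_of G b & field_of G c],
      forall a b, field_of G a -> field_of G b -> exists c, G (a, b, c) &
      forall a b a' b' c, G (a, b, c) -> G (a', b', c) -> a = a' /\ b = b'].

Let pairing_bigcup (F : set (set (M * M * M))) :
  F `<=` pairing -> total_on F subset -> pairing (\bigcup_(G in F) G).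
Proof.
move=> Fp Ft.
have up G a : F G -> field_of G a -> field_of (\bigcup_(G in F) G) a.
  by move=> FG [c Gc]; exists c; exists G.
have two t t' G G' : F G -> F G' -> G t -> G' t' ->
    exists2 H, F H & H t /\ H t'.
  move=> FG FG' Gt Gt'; have [GG'|G'G] := Ft _ _ FG FG'.
    by exists G' => //; split=> //; exact: GG'.
  by exists G => //; split=> //; exact: G'G.
split.
- move=> a b c [G FG Gabc]; have [/(_ _ _ _ Gabc)[ha hb hc] _ _] := Fp _ FG.
  by split; exact: up FG _.
- move=> a b [c [G FG Gc]] [d [H FH Hd]].
  have [N FN [Na Nb]] := two _ _ _ _ FG FH Gc Hd.
  have [_ /(_ a b) tN _] := Fp _ FN.
  by have [||e Ne] := tN; [exists c|exists d|exists e, N].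
- move=> a b a' b' c [G FG Gc] [H FH Hc].
  have [N FN [Na Nb]] := two _ _ _ _ FG FH Gc Hc.
  by have [_ _ inj] := Fp _ FN; exact: inj Na Nb.
Qed.

Let pairing_fun G : pairing G -> exists p : M -> M -> M,
  forall a b, field_of G a -> field_of G b -> G (a, b, p a b).
Proof.
move=> [_ Gt _].
have exq a b : exists c, field_of G a -> field_of G b -> G (a, b, c).
  have [[Aa Ab]|nAB] := pselect (field_of G a /\ field_of G b).
    by have [c] := Gt _ _ Aa Ab; exists c.
  by exists a => Aa Ab; case: nAB.
exists (fun a b => sval (cid (exq a b))) => a b.
exact: svalP (cid (exq a b)).
Qed.

(** If the carrier [A] embeds by [h] into its complement, the pairing extends to
    [A] together with [h A]: the three new blocks of the square are all coded
    inside [h A], and the constants [e] keep the blocks apart. *)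
Let pairing_extend G (h : M -> M) (e : bool * bool -> M) : pairing G ->
  (forall i, field_of G (e i)) -> injective e ->
  (forall a, field_of G a -> ~ field_of G (h a)) ->
  (forall a b, field_of G a -> field_of G b -> h a = h b -> a = b) ->
  exists H, pairing H /\ G `<` H.
Proof.
move=> pG eG einj hG hinj; have [p pP] := pairing_fun pG.
move: pG => [Gf Gt Gi]; set A := field_of G in hG hinj eG pP *.
have pA a b : A a -> A b -> A (p a b).
  by move=> Aa Ab; have [] := Gf _ _ _ (pP _ _ Aa Ab).
have pinj a b a' b' : A a -> A b -> A a' -> A b' -> p a b = p a' b' ->
    a = a' /\ b = b'.
  move=> Aa Ab Aa' Ab' E; apply: (Gi _ _ _ _ (p a b)); first exact: pP.
  by rewrite E; exact: pP.
pose r (s : bool) a := if s then h a else a.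
have rinj s a s' a' : A a -> A a' -> r s a = r s' a' -> s = s' /\ a = a'.
  move=> Aa Aa'; case: s; case: s' => //= E; split=> //.
  - exact: hinj.
  - by case: (hG _ Aa); rewrite E.
  - by case: (hG _ Aa); rewrite E.
  - by case: (hG _ Aa'); rewrite -E.
  - by case: (hG _ Aa'); rewrite -E.
pose c i a b := p (e i) (p a b).
pose N := [set t | exists s s' a b, [/\ s || s', A a, A b &
  t = (r s a, r s' b, h (c (s, s') a b))]].
have cA i a b : A a -> A b -> A (c i a b).
  by move=> Aa Ab; exact: (pA _ _ (eG i) (pA _ _ Aa Ab)).
have cinj i a b i' a' b' : A a -> A b -> A a' -> A b' ->
    h (c i a b) = h (c i' a' b') -> [/\ i = i', a = a' & b = b'].
  move=> Aa Ab Aa' Ab' /(hinj _ _ (cA _ _ _ Aa Ab) (cA _ _ _ Aa' Ab')).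
  move=> /(pinj _ _ _ _ (eG _) (pA _ _ Aa Ab) (eG _) (pA _ _ Aa' Ab')).
  by move=> [/einj -> /pinj[]].
have fN s a : A a -> field_of (G `|` N) (r s a).
  case: s => Aa; last by case: (Aa) => x Gx; exists x; left.
  by exists (h (c (true, true) a a)); right; exists true, true, a, a.
have Nf a : field_of (G `|` N) a -> exists s x, A x /\ a = r s x.
  move=> [x [Gx|[s [s' [y [z [_ Ay Az]]]]]]].
    by exists false, a; split=> //; exists x.
  by case=> -> _ _; exists s, y.
exists (G `|` N); split; last first.
  split; first exact: subsetUl.
  pose i := (true, true); have Ai := eG i.
  move=> /(_ (h (e i), h (e i), h (c i (e i) (e i)))) GN.
  case: (hG _ Ai); exists (h (c i (e i) (e i))); apply: GN; right.
  by exists true, true, (e i), (e i).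
split.
- move=> a b d [/Gf[Aa Ab Ad]|].
    by split; [exact: fN false _ Aa|exact: fN false _ Ab|exact: fN false _ Ad].
  move=> [s [s' [x [y [_ Ax Ay]]]]] [-> -> ->]; split; try exact: fN.
  by apply: (fN true); exact: cA.
- move=> _ _ /Nf[s [x [Ax ->]]] /Nf[s' [y [Ay ->]]].
  have [ss|/norP[/negbTE -> /negbTE ->]] := boolP (s || s').
    by exists (h (c (s, s') x y)); right; exists s, s', x, y.
  by exists (p x y); left; exact: pP.
- move=> a b a' b' d [Gd|[s [s' [x [y [_ Ax Ay Exy]]]]]].
  + move=> [Gd'|[t [t' [x' [y' [_ Ax' Ay' [_ _ Ed]]]]]]].
      exact: Gi Gd Gd'.
    by have [_ _] := Gf _ _ _ Gd; rewrite Ed => /(hG _ (cA _ _ _ Ax' Ay')).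
  + case: Exy => -> -> ->.
    move=> [Gd'|[t [t' [x' [y' [_ Ax' Ay' [-> -> E]]]]]]].
      by have [_ _ /(hG _ (cA _ _ _ Ax Ay))] := Gf _ _ _ Gd'.
    by have [//|//|//|//|[-> ->] -> ->] := cinj _ _ _ _ _ _ _ _ _ _ E.
Qed.

Lemma card_square_le : infinite_set [set: M] -> [set: M * M] #<= [set: M].
Proof.
move=> /infiniteP/card_le_injP[k kinj].
(* Adding the fixed pairing [G0] to every set in the application of Zorn's lemma
   makes the carrier of the maximal element infinite. *)
pose G0 : set (M * M * M) :=
  [set t | exists i j : nat, t = (k i, k j, k (pickle (i, j)))].
have [G [pG maxG]] : exists G, pairing (G0 `|` G) /\
    forall H, G `<` H -> ~ pairing (G0 `|` H).
  pose P := [set G | pairing (G0 `|` G)].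
  have [F Fp Ft|G [PG maxG]] := @Zorn_bigcup _ P; last by exists G.
  pose F' := [set G0 `|` X | X in F `|` [set set0]].
  rewrite /P /=.
  have -> : G0 `|` \bigcup_(X in F) X = \bigcup_(X in F') X.
    apply/seteqP; split=> [t [G0t|[X FX Xt]]|t [_ [X [FX|->] <-] [|]]].
    - by exists (G0 `|` set0); [exists set0 => //; right|left].
    - by exists (G0 `|` X); [exists X => //; left|right].
    - by left.
    - by move=> Xt; right; exists X.
    - by left.
    - by [].
  apply: pairing_bigcup.
    move=> _ [X [FX|->] <-]; first exact: Fp.
    rewrite setU0.
    have fk j : field_of G0 (k j) by exists (k (pickle (j, j))), j, j.
    split.
    - by move=> _ _ _ [i [j [-> -> ->]]].
    - move=> a b [_ [i [_ [-> _ _]]]] [_ [j [_ [-> _ _]]]].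
      by exists (k (pickle (i, j))), i, j.
    - move=> a b a' b' c [i [j [-> -> ->]]] [i' [j' [-> -> /kinj]]].
      by move=> /(pcan_inj pickleK)[-> ->].
  move=> _ _ [X FX <-] [Y FY <-].
  have [XY|YX] : X `<=` Y \/ Y `<=` X.
  - by case: FX FY => [FX|->] [FY|->]; [exact: Ft|right|left|left].
  - by left; exact: setUS.
  - by right; exact: setUS.
set A := field_of (G0 `|` G).
have Ak j : A (k j) by exists (k (pickle (j, j))); left; exists j, j.
pose e (i : bool * bool) := k (pickle i).
have einj : injective e by move=> i j /kinj /(pcan_inj pickleK).
(* Either the complement of the carrier is large, and the pairing extends, or it
   embeds into the carrier, and [M] is at most two copies of the carrier. *)
have [/(card_le_funP (k 0%N))[h [hA hinj]]|] := card_total A (~` A).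
  have [H [pH GH]] := pairing_extend pG (fun i => Ak _) einj hA hinj.
  have G0H : G0 `|` H = H.
    by rewrite setUidr // => t G0t; apply: GH.1; left.
  case: (maxG H); last by rewrite G0H.
  split=> [t Gt|HG]; first by apply: GH.1; right.
  by apply: GH.2 => t /HG; right.
move=> /(card_le_funP (k 0%N))[h [hA hinj]].
have [p pP] := pairing_fun pG.
have [Gf _ Gi] := pG.
have pA a b : A a -> A b -> A (p a b).
  by move=> Aa Ab; have [] := Gf _ _ _ (pP _ _ Aa Ab).
have pinj a b a' b' : A a -> A b -> A a' -> A b' -> p a b = p a' b' ->
    a = a' /\ b = b'.
  move=> Aa Ab Aa' Ab' E; apply: (Gi _ _ _ _ (p a b)); first exact: pP.
  by rewrite E; exact: pP.
pose j x := if pselect (A x) then p (k 0%N) x else p (k 1%N) (h x).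
have jA x : A (j x).
  by rewrite /j; case: pselect => Ax; apply: pA => //; exact: hA.
have jinj : injective j.
  move=> x y; rewrite /j; case: pselect => Ax; case: pselect => Ay.
  - by move=> /pinj[].
  - by move=> /pinj[] // => [|/kinj]; first exact: hA.
  - by move=> /pinj[] // => [|/kinj]; first exact: hA.
  - by move=> /pinj[] // => [||_]; [exact: hA|exact: hA|exact: hinj].
apply/card_le_injP; exists (fun xy => p (j xy.1) (j xy.2)).
by move=> [x y] [x' y'] /= /pinj[] // /jinj -> /jinj ->.
Qed.

End InfiniteSquare.

Lemma card_seq_le (M : Type) :
  infinite_set [set: M] -> [set: seq M] #<= [set: M].
Proof.
move=> infM; have /card_le_injP[p pinj] := card_square_le infM.
have /infiniteP/card_le_injP[k kinj] := infM.
pose fold := foldr (fun x y => p (x, y)) (k 0%N).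
apply/card_le_injP; exists (fun s => p (k (size s), fold s)).
move=> s t /pinj [/kinj]; elim: s t => [|x s IH] [|y t] //= [sz] /pinj [-> ft].
by rewrite (IH t).
Qed.

Lemma card_le_prod (S S' T T' : Type) : [set: S] #<= [set: S'] ->
  [set: T] #<= [set: T'] -> [set: S * T] #<= [set: S' * T'].
Proof.
move=> /card_le_injP[f finj] /card_le_injP[g ginj]; apply/card_le_injP.
by exists (fun x => (f x.1, g x.2)) => -[x y] [x' y'] [/finj -> /ginj ->].
Qed.

Section PowerBounds.
Variables (K : Type) (infK : infinite_set [set: K]).

(** [(2 ^ K) ^ K = 2 ^ (K * K)]: a function is coded by the set of values under
    the pairing [p] of the pairs [(a, k)] for which [k] belongs to the image
    of [a]. *)
Lemma card_fun_le_power (A L : Type) : [set: A] #<= [set: K] ->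
  [set: L] #<= [set: K -> bool] -> [set: A -> L] #<= [set: K -> bool].
Proof.
move=> AK /card_le_injP[f finj].
have /card_le_injP[p pinj] : [set: A * K] #<= [set: K].
  exact: card_le_trans (card_le_prod AK (card_lexx _)) (card_square_le infK).
apply/card_le_injP.
exists (fun g k => `[< exists a k', p (a, k') = k /\ f (g a) k' >]) => g g' E.
apply/funext => a; apply/finj/funext => k.
have {}E := congr1 (fun F => F (p (a, k))) E.
have dec (q : A -> L) : `[< exists b k', p (b, k') = p (a, k) /\ f (q b) k' >]
    = f (q a) k.
  apply/asboolP/idP => [[b [k' [/pinj[-> ->]]]]//|fk].
  by exists a, k.
by rewrite -dec E dec.
Qed.

Lemma card_bool_le : [set: bool] #<= [set: K].
Proof.
have /infiniteP/card_le_injP[k kinj] := infK.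
by apply/card_le_injP; exists (k \o nat_of_bool); case=> -[] // /kinj.
Qed.

Lemma card_le_power : [set: K] #<= [set: K -> bool].
Proof.
apply/card_le_injP; exists (fun x y => `[< x = y >]) => x y.
by move=> /(congr1 (@^~ y)) /= E; apply/asboolP; rewrite E; exact/asboolP.
Qed.

Lemma card_prod_le_power (L L' : Type) : [set: L] #<= [set: K -> bool] ->
  [set: L'] #<= [set: K -> bool] -> [set: L * L'] #<= [set: K -> bool].
Proof.
move=> /card_le_injP[f finj] /card_le_injP[f' finj'].
apply: card_le_trans (card_fun_le_power card_bool_le (card_lexx _)).
apply/card_le_injP.
exists (fun x b => if b then f x.1 else f' x.2) => -[x x'] [y y'] E.
have := congr1 (@^~ true) E; have := congr1 (@^~ false) E.
by move=> /= /finj' -> /finj ->.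
Qed.

Lemma card_option_le_power (L : Type) : [set: L] #<= [set: K -> bool] ->
  [set: option L] #<= [set: K -> bool].
Proof.
move=> /card_le_injP[f finj].
apply: card_le_trans (card_prod_le_power _ (card_lexx _)); last first.
  exact: card_le_trans card_bool_le card_le_power.
apply/card_le_injP.
exists (fun o => if o is Some x then (true, f x) else (false, fun=> false)).
by move=> [x|] [y|] //= [/finj ->].
Qed.

End PowerBounds.

(** * Closing off under operations of large arity *)

Section ClosingOff.
Variables (A L : Type).

(** The terms over operations of arity [A] labelled by [L]; the closure of a
    point under the operations is the set of values of the terms. *)
Inductive term := Base | Op of L & (A -> term).

(** A well-founded tree is determined by the labels met along the finite
    paths from its root, which bounds the number of trees with no recourse to ordinals. *)
Fixpoint term_code (t : term) (s : seq A) : option L :=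
  match t, s with
  | Base, _ => None
  | Op l _, [::] => Some l
  | Op _ g, a :: s' => term_code (g a) s'
  end.

Lemma term_code_inj : injective term_code.
Proof.
elim=> [|l g IH] [|l' g'] // E.
- by have := congr1 (@^~ [::]) E.
- by have := congr1 (@^~ [::]) E.
have [->] := congr1 (@^~ [::]) E; congr (Op _ _).
by apply/funext => a; apply/IH/funext => s; exact: (congr1 (@^~ (a :: s)) E).
Qed.

End ClosingOff.

(** A set of size at most [2 ^ K] closed under [2 ^ K] operations of arity at
    most [K], each of them with at most [2 ^ K] values: the values of the terms
    whose labels record an operation and the index of one of its values. *)
Lemma closing_off (K A L1 L2 T : Type) (Phi : L1 -> (A -> T) -> set T)
    (t0 : T) : infinite_set [set: K] -> [set: A] #<= [set: K] ->
  [set: L1] #<= [set: K -> bool] -> [set: L2] #<= [set: K -> bool] ->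
  (forall l a, Phi l a #<= [set: L2]) ->
  exists H : set T, [/\ H t0,
    forall l a, (forall i, H (a i)) -> Phi l a `<=` H &
    H #<= [set: K -> bool]].
Proof.
move=> infK AK L1K L2K PhiL.
pose e l a := cid (card_le_rangeP t0 (PhiL l a)).
pose value := fix value (t : term A (L1 * L2)) : T :=
  match t with
  | Base => t0
  | Op (l1, l2) g => sval (e l1 (fun i => value (g i))) l2
  end.
exists (range value); split.
- by exists (Base _ _).
- move=> l a Ha x xPhi.
  have /choice[t ta] i : exists t, value t = a i.
    by have [t _ <-] := Ha i; exists t.
  have {}ta : (fun i => value (t i)) = a by exact/funext.
  have [l' _ lx] := svalP (e l a) _ xPhi.
  by exists (Op (l, l') t) => //=; rewrite ta.
- apply: card_le_trans (card_image_le _ _) _.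
  have code : [set: term A (L1 * L2)] #<= [set: seq A -> option (L1 * L2)].
    by apply/card_le_injP; exists (@term_code _ _); exact: term_code_inj.
  apply: card_le_trans code _; apply: (card_fun_le_power infK).
    have /card_le_injP[f finj] := AK.
    apply: card_le_trans (card_seq_le infK).
    by apply/card_le_injP; exists (map f); exact: inj_map.
  exact/(card_option_le_power infK)/(card_prod_le_power infK).
Qed.

(** * Fibres of a compact space *)

(** Zorn's lemma is applied below to a property of finite character relative to
    [B]; the empty set accounts for the empty chain. *)
Lemma subset_seq_bigcup (T : eqType) (F : set (set T)) (B : set T) (s : seq T) :
  total_on F subset ->
  (forall x, x \in s -> (B `|` \bigcup_(S in F) S) x) ->
  exists2 S, (F `|` [set set0]) S & forall x, x \in s -> (B `|` S) x.
Proof.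
move=> totF; elim: s => [_|x s IH sF]; first by exists set0 => //; right.
have [y ys|S FS sS] := IH; first by apply: sF; rewrite inE ys orbT.
case: (sF x (mem_head _ _)) => [Bx|[S' FS' S'x]].
  by exists S => // y; rewrite inE => /predU1P[->|/sS//]; left.
have [SS'|S'S] : S `<=` S' \/ S' `<=` S.
- by case: FS => [FS|->]; [exact: totF|left].
- exists S'; first by left.
  by move=> y; rewrite inE => /predU1P[->|/sS[By|/SS' Sy]]; [right|left|right].
- exists S => // y; rewrite inE => /predU1P[->|/sS//].
  by right; exact: S'S.
Qed.

(** If the sets [V p] are taken as open, the last hypothesis is compactness of
    [Z], and every fibre of [f] is an intersection of [K] open sets.

    Let [H] contain a cluster point of every net of points of [H] indexed by the
    finite sequences in [K], and, for every family of [K] of the open sets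
    attached to fibres meeting [H] that does not cover [Z], a point outside it.
    Suppose that the fibre of [q] misses [H], and choose for every [h] in [H] one
    of the open sets [V (f h, i)] with [q] outside it.  No finite number of them
    cover [H].  Extend the family [B] of the chosen sets to a maximal family
    [B `|` S] such that no finite subfamily covers [H], and take [z] outside all
    the members.  By maximality, for every [j] the trace of [V (f z, j)] on [H]
    together with finitely many members covers [H].  A point [b] of [H] that is a
    cluster point of points avoiding more and more of these finite families
    avoids them all, so it lies in every [V (f z, j)], that is, in the fibre of
    [z].  Then [z] lies in the set chosen for [b], against the choice of [z]. *)
Lemma card_range_le_power (K Y : choiceType) (Z : Type) (f : Z -> Y)
    (V : Y * K -> set Z) :
  infinite_set [set: K] ->
  (forall z y, f z = y <-> forall i, V (y, i) z) ->
  (forall S : set (Y * K),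
    (forall s : seq (Y * K), (forall p, p \in s -> S p) ->
      exists z, forall p, p \in s -> ~ V p z) ->
    exists z, forall p, S p -> ~ V p z) ->
  range f #<= [set: K -> bool].
Proof.
move=> infK fV compactV.
have [[z0]|noZ] := pselect (inhabited Z); last first.
  suff -> : range f = set0 by exact: card_ge0.
  by rewrite -subset0 => y [z _ _]; apply: noZ; exists.
(* [c a] is a cluster point of the net [a], ordered by inclusion of sequences. *)
have /(_ _)/cid c (a : seq K -> Z) : exists c, forall p,
    (exists s0 : seq K, forall s, {subset s0 <= s} -> ~ V p (a s)) -> ~ V p c.
  apply: (compactV [set p |
    exists s0 : seq K, forall s, {subset s0 <= s} -> ~ V p (a s)]).
  move=> s sS; suff [s1 s1P] : exists s1 : seq K, forall p, p \in s ->
      forall s', {subset s1 <= s'} -> ~ V p (a s').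
    by exists (a s1) => p /s1P; apply.
  elim: s sS => [|p s IH] sS; first by exists [::].
  have [p' ps|s1 s1P] := IH; first by apply: sS; rewrite inE ps orbT.
  have [s0 s0P] := sS p (mem_head _ _).
  exists (s0 ++ s1) => p'; rewrite inE => /predU1P[->|/s1P h] s' ss'.
    by apply: s0P => x x0; apply: ss'; rewrite mem_cat x0.
  by apply: h => x x0; apply: ss'; rewrite mem_cat x0 orbT.
(* [w i a] is outside the union of the sets [V (f (a s), i s)], unless this
   union is [Z]. *)
have exw (i : seq K -> K) (a : seq K -> Z) : exists w,
    (exists z, forall s, ~ V (f (a s), i s) z) ->
    forall s, ~ V (f (a s), i s) w.
  by have [[z zP]|nz] := pselect (exists z, forall s, ~ V (f (a s), i s) z);
    [exists z|exists z0].
pose w i a := cid (exw i a).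
pose Phi (l : option (seq K -> K)) a :=
  [set if l is Some i then sval (w i a) else sval (c a)].
have K2 := card_le_power K.
have [|||| H [Hz0 HPhi HK]] := @closing_off K (seq K) _ unit Z Phi z0 infK.
- exact: card_seq_le.
- apply: (card_option_le_power infK).
  by apply: (card_fun_le_power infK) => //; exact: card_seq_le.
- apply: card_le_trans K2; apply/card_le_injP.
  have /infiniteP/card_le_injP[k _] := infK.
  by exists (fun=> k 0%N) => -[] [].
- move=> l a; apply: (@card_le_range _ _
    (fun=> if l is Some i then sval (w i a) else sval (c a))) => _ ->.
  by exists tt.
have Hc a : (forall s, H (a s)) -> H (sval (c a)).
  by move=> /(HPhi None); apply.
have Hw i a : (forall s, H (a s)) -> H (sval (w i a)).
  by move=> /(HPhi (Some i)); apply.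
suff fH : range f `<=` f @` H.
  apply: card_le_trans (subset_card_le fH) _.
  exact: card_le_trans (card_image_le _ _) HK.
move=> _ [q _ <-]; apply: contrapT => fq.
have /(_ _)/cid i h : exists i, H h -> ~ V (f h, i) q.
  have [Hh|nHh] := pselect (H h).
    apply: contrapT => /forallNP hV; apply: fq; exists h => //.
    apply/esym/fV => i; by apply: contrapT => nV; apply: (hV i).
  have /infiniteP/card_le_injP[k _] := infK.
  by exists (k 0%N).
pose P h := (f h, sval (i h)).
pose B := P @` H.
pose Q S := forall s : seq (Y * K), (forall p, p \in s -> (B `|` S) p) ->
  exists2 h, H h & forall p, p \in s -> ~ V p h.
(* A finite subfamily of [B] is turned into one indexed by all finite sequences:
   the sequence of length [n] is given its [n]-th member, and the member chosen
   for [z0] beyond the end, so that [q] still lies outside the union. *)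
have Q0 : Q set0.
  move=> s; rewrite setU0 => sB.
  have /(_ _)/cid2 h n : exists2 h, H h & P h = nth (P z0) s n.
    have [ns|sn] := ltnP n (size s).
      by have [h Hh hE] := sB _ (mem_nth (P z0) ns); exists h.
    by exists z0 => //; rewrite nth_default.
  pose a (x : seq K) := s2val (h (size x)).
  pose ia x := sval (i (a x)).
  exists (sval (w ia a)); first by apply: Hw => x; exact: s2valP.
  move=> p /(nthP (P z0))[n _ <-].
  have : forall x, ~ V (f (a x), ia x) (sval (w ia a)).
    apply: (svalP (w ia a)); exists q => x.
    by apply: (svalP (i (a x))); exact: s2valP.
  move=> /(_ (nseq n (sval (i z0)))).
  by rewrite -(s2valP' (h n)) /P /ia /a size_nseq.
have [F FQ totF|S [QS maxS]] := @Zorn_bigcup _ Q.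
  move=> s /(subset_seq_bigcup totF)[S FS sS].
  suff QS : Q S by exact: QS.
  by case: FS => [/FQ//|->].
have [z zS] : exists z, forall p, (B `|` S) p -> ~ V p z.
  by apply: compactV => s /QS[h _ hs]; exists h.
have fz j : V (f z, j) z by exact: (iffLR (fV z (f z))).
(* The pair [(f z, j)] is not in [B `|` S], so adding it to [S] spoils [Q]. *)
have /(_ _)/cid2 sj j : exists2 s : seq (Y * K),
    (forall p, p \in s -> (B `|` S) p) &
    forall h, H h -> (forall p, p \in s -> ~ V p h) -> V (f z, j) h.
  have : ~ Q (S `|` [set (f z, j)]).
    apply: maxS; split; first exact: subsetUl.
    move=> /(_ (f z, j) (or_intror erefl)) Szj.
    by apply: (zS (f z, j)) => //; right.
  move=> /existsNP[s /not_implyP[sS /forall2NP sH]].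
  exists [seq p <- s | p != (f z, j)].
    move=> p; rewrite mem_filter => /andP[/eqP pz /sS[Bp|[Sp|//]]].
      by left.
    by right.
  move=> h Hh hs; apply: contrapT => nV.
  have [//|[]] := sH h => p ps.
  have [->//|pz] := eqVneq p (f z, j).
  by apply: hs; rewrite mem_filter pz.
have /(_ _)/cid2 a (s : seq K) : exists2 h, H h &
    forall j, j \in s -> forall p, p \in s2val (sj j) -> ~ V p h.
  have [|h Hh hP] := QS (flatten [seq s2val (sj j) | j <- s]).
    by move=> p /flattenP[_ /mapP[j _ ->]]; exact: s2valP (sj j) p.
  exists h => // j js p pj; apply: hP; apply/flattenP.
  by exists (s2val (sj j)) => //; exact: map_f.
pose b := sval (c (fun s => s2val (a s))).
have Hb : H b by apply: Hc => s; exact: s2valP.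
have fb : f b = f z.
  apply/fV => j; apply: (s2valP' (sj j)) => // p pj.
  apply: (svalP (c _)); exists [:: j] => s js.
  by apply: (s2valP' (a s)) pj; apply: js; rewrite mem_head.
apply: (zS (P b)); first by left; exists b.
by rewrite /P; move: (sval (i b)) => j; rewrite fb.
Qed.

(** * H-closed spaces and open filters *)

Section AdjoinLimit.
Variables (Y : topologicalType) (F : set_system Y) (FF : ProperFilter F).

(** [Y] with a point [None] added, whose neighbourhoods are generated by the
    open members of [F]; [F] enters only the topology. *)
Definition adjoin_limit : Type := option Y.

HB.instance Definition _ := Choice.on adjoin_limit.

Definition adjoin_limit_open : set_system adjoin_limit :=
  [set A | open (Some @^-1` A) /\ (A None -> F (Some @^-1` A))].

Let openT : adjoin_limit_open setT.
Proof. by split=> [|_]; [exact: openT|exact: filterT]. Qed.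

Let openI : setI_closed adjoin_limit_open.
Proof.
move=> A B [oA FA] [oB FB]; split; first exact: openI.
by move=> [/FA ? /FB ?]; exact: filterI.
Qed.

Let open_bigU (I : Type) (A : I -> set adjoin_limit) :
  (forall i, adjoin_limit_open (A i)) -> adjoin_limit_open (\bigcup_i A i).
Proof.
move=> oA; split.
  by rewrite preimage_bigcup; apply: bigcup_open => i _; exact: (oA i).1.
move=> [i _ /((oA i).2)]; apply: filterS => y Ay; by exists i.
Qed.

HB.instance Definition _ :=
  isOpenTopological.Build adjoin_limit openT openI open_bigU.

Lemma embedding_adjoin_limit : embedding (Some : Y -> adjoin_limit).
Proof.
split=> [x y []//|U]; split=> [oU|[V [oV _] <-]//].
have SU : Some @^-1` (Some @` U) = U.
  by apply/seteqP; split=> [y [x Ux [<-]]//|y Uy]; exists y.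
by exists (Some @` U : set adjoin_limit) => //; split; rewrite SU // => -[].
Qed.

Lemma adjoin_limit_not_closed : ~ closed (range (Some : Y -> adjoin_limit)).
Proof.
move=> /(_ None) cl; suff : range (Some : Y -> adjoin_limit) None by case.
apply: cl => A; rewrite nbhsE => -[V [[_ FV] VN] VA].
have [y Vy] := filter_ex (FV VN).
by exists (Some y); split; [exists y|exact: VA].
Qed.

(** The new point is separated from [y] exactly by an open member of [F] whose
    closure misses [y]. *)
Lemma adjoin_limit_hausdorff : hausdorff_space Y ->
  (forall y, exists U, [/\ open U, F U & ~ closure U y]) ->
  hausdorff_space adjoin_limit.
Proof.
move=> hY Fy.
have sepN y : exists A B : set adjoin_limit,
    [/\ open A, open B, A (Some y), B None & A `&` B = set0].
  have [U [oU FU Uy]] := Fy y.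
  exists (Some @` (~` closure U)), (None |` Some @` U).
  have S1 : Some @^-1` (Some @` (~` closure U)) = ~` closure U.
    by apply/seteqP; split=> [z [x Ux [<-]]//|z Uz]; exists z.
  have S2 : Some @^-1` (None |` Some @` U) = U.
    by apply/seteqP; split=> [z [//|[x Ux [<-]]]//|z Uz]; right; exists z.
  split.
  - split; rewrite S1; last by case.
    by apply: closed_openC; exact: closed_closure.
  - by split; rewrite S2.
  - by exists y.
  - by left.
  - rewrite -subset0 => _ [[z nUz <-] [//|[x Ux [xz]]]].
    by apply: nUz; rewrite -xz; exact: subset_closure.
rewrite open_hausdorff => -[x|] [y|] //= xy.
- move: hY; rewrite open_hausdorff => /(_ x y)[].
    by apply: contra_neq xy => ->.
  move=> [A B] /= [Ax By] [oA oB AB].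
  have SE (U : set Y) : Some @^-1` (Some @` U) = U.
    by apply/seteqP; split=> [z [z' Uz [<-]]//|z Uz]; exists z.
  exists (Some @` A : set adjoin_limit, Some @` B : set adjoin_limit) => /=.
    by rewrite !inE in Ax By *; split; [exists x|exists y].
  split; [by split; rewrite SE // => -[]|by split; rewrite SE // => -[]|].
  apply/eqP; rewrite -subset0 => _ [[z Az <-] [z' Bz [zz]]].
  by move/eqP: AB; rewrite -subset0 => /(_ z); apply; split=> //; rewrite -zz.
- have [A [B [oA oB Ax BN AB]]] := sepN x.
  by exists (A, B) => /=; [rewrite !inE|split=> //; exact/eqP].
- have [A [B [oA oB Ay BN AB]]] := sepN y.
  by exists (B, A) => /=; [rewrite !inE|split=> //; rewrite setIC; exact/eqP].
Qed.

End AdjoinLimit.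

(** If the open members of [F] had no common cluster point, [Y] would be
    embedded in the Hausdorff space [adjoin_limit], where the new point is in
    its closure. *)
Lemma H_closed_cluster (Y : topologicalType) (F : set_system Y) :
  H_closed Y -> ProperFilter F ->
  exists y, forall U, open U -> F U -> closure U y.
Proof.
move=> [hY Ycl] FF; apply: contrapT => /forallNP nF.
apply: (@adjoin_limit_not_closed Y F FF); apply: Ycl.
  apply: adjoin_limit_hausdorff => // y.
  have /existsNP[U /not_implyP[oU /not_implyP[FU Uy]]] := nF y.
  by exists U.
exact: embedding_adjoin_limit.
Qed.

(** For open [B], this is H-closedness of the closure of [B], expressed in the
    ambient space. *)
Definition open_filters_cluster (X : topologicalType) (B : set X) :=
  forall F : set_system X, ProperFilter F -> F B ->
  exists y, forall U, open U -> F U -> closure U y.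

Lemma H_closed_open_filters_cluster (X : topologicalType) (B : set X) :
  H_closed (set_type (closure B)) -> open_filters_cluster B.
Proof.
move=> HB F FF FB; pose F' : set_system (set_type (closure B)) :=
  [set A | F (set_val @` A)].
have valF (U : set X) : F U -> F' (set_val @^-1` U).
  move=> FU; rewrite /F' /=; apply: filterS (filterI FU FB) => x [Ux Bx].
  by exists (SigSub (mem_set (subset_closure Bx))).
have FilF' : Filter F'.
  split.
  - exact: (valF _ (filterT : F setT)).
  - move=> P Q FP FQ.
    have FPQ : F (set_val @` P `&` set_val @` Q) by exact: filterI.
    rewrite /F' /=; apply: filterS FPQ.
    move=> _ [[x Px <-] [y Qy /val_inj yx]].
    by exists x => //; rewrite -yx in Px *.
  - move=> P Q PQ; rewrite /F' /=; apply: filterS => _ [x Px <-].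
    by exists x => //; exact: PQ.
have FF' : ProperFilter F'.
  apply: Build_ProperFilter_ex => A FA.
  by have [_ [x Ax _]] := filter_ex (FA : F (set_val @` A)); exists x.
have [y yP] := H_closed_cluster HB FF'.
exists (set_val y) => U oU FU W Wy.
have oU' : open (set_val @^-1` U : set (set_type (closure B))) by exists U.
have /(_ (set_val @^-1` W))[|x [Ux Wx]] := yP _ oU' (valF _ FU).
  exact: (@initial_continuous _ _ (@set_val X (closure B))).
by exists (set_val x).
Qed.

(** The Dow-Porter bound.  Here [Z] plays the role of the absolute of the
    closure of [B]: the open members of an ultrafilter that contains all dense
    open sets form an open ultrafilter.  The map [f] sends it to its limit, and
    [f z = x] if and only if [z] contains all the [V x i]. *)
Lemma card_closure_le_power (K : choiceType) (X : topologicalType)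
    (V : X -> K -> set X) (B : set X) : infinite_set [set: K] ->
  (forall x i, open_nbhs x (V x i)) ->
  (forall x, \bigcap_i closure (V x i) = [set x]) ->
  open B -> open_filters_cluster B -> closure B #<= [set: K -> bool].
Proof.
move=> infK oV clV oB clusterB.
pose Z := {u : set_system X |
  [/\ UltraFilter u, u B & forall D, open D -> dense D -> u D]}.
have /(_ _)/cid f (z : Z) : exists y,
    forall U, open U -> sval z U -> closure U y.
  by case: z => u [uU uB _] /=; exact: clusterB.
(* [z] contains [W] or the complement of its closure, the union of the two being
   dense; a cluster point of the open members of [z] excludes the second. *)
have fnbhs (z : Z) W : open W -> W (sval (f z)) -> sval z W.
  case: z (f z) => u /= [uU uB uD] [y yP] /= oW Wy.
  have oC : open (~` closure W) by apply: closed_openC; exact: closed_closure.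
  have : u (W `|` ~` closure W).
    apply: uD; first exact: openU.
    move=> O [x Ox] oO; have [[w [Ww Ow]]|OW] := pselect (W `&` O !=set0).
      by exists w; split=> //; left.
    exists x; split=> //; right => Wx; apply: OW.
    by apply: Wx; apply: open_nbhs_nbhs.
  have [//|nW uWC] := in_ultra_setVsetC W uU.
  have uC : u (~` closure W).
    by apply: filterS (filterI nW uWC) => x [nWx []].
  have [w [nWw Ww]] := yP _ oC uC W (open_nbhs_nbhs (conj oW Wy)).
  by case: nWw; exact: subset_closure.
pose VZ (p : X * K) : set Z := [set z | sval z (V p.1 p.2)].
have fV (z : Z) x : sval (f z) = x <-> forall i, VZ (x, i) z.
  split=> [<- i|zV].
    by apply: fnbhs; have [] := oV (sval (f z)) i.
  have : [set x] (sval (f z)).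
    rewrite -clV => i _; apply: (svalP (f z)); last exact: zV.
    by have [] := oV x i.
  by [].
(* Compactness of [Z]: sets that belong to every point of [Z] lying outside some
   finite subfamily of [S] form a filter. *)
suff Bf : closure B `<=` range (fun z => sval (f z)).
  apply: card_le_trans (subset_card_le Bf) _.
  apply: (card_range_le_power infK fV) => S fipS.
  pose F : set_system X := [set A |
    exists2 s : seq (X * K), (forall p, p \in s -> S p) &
    forall z : Z, (forall p, p \in s -> ~ VZ p z) -> sval z A].
  have FF : ProperFilter F.
    apply: Build_ProperFilter_ex => [A [s sS sA]|].
      have [z zs] := fipS s sS; have [uU _ _] := svalP z.
      exact: filter_ex (sA z zs).
    split.
    - by exists [::] => // z _; have [uU _ _] := svalP z; exact: filterT.
    - move=> P Q [s sS sP] [t tS tQ]; exists (s ++ t).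
        by move=> p; rewrite mem_cat => /orP[/sS|/tS].
      move=> z zst; have [uU _ _] := svalP z.
      by apply: filterI; [apply: sP|apply: tQ] => p ps; apply: zst;
        rewrite mem_cat ps ?orbT.
    - move=> P Q PQ [s sS sP]; exists s => // z zs; have [uU _ _] := svalP z.
      by apply: filterS PQ _; exact: sP.
  have [u [uU Fu]] := ultraFilterLemma FF.
  have uZ : [/\ UltraFilter u, u B & forall D, open D -> dense D -> u D].
    split=> // [|D oD dD]; apply: Fu; exists [::] => // z _;
      have [_ zB zD] := svalP z => //.
    exact: zD.
  exists (exist _ u uZ) => p Sp /= uV.
  have uVC : u (~` V p.1 p.2).
    apply: Fu; exists [:: p] => [q|z zp]; first by rewrite inE => /eqP ->.
    have [uU' _ _] := svalP z.
    have [zV|//] := in_ultra_setVsetC (V p.1 p.2) uU'.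
    by case: (zp p (mem_head _ _)).
  by have [x []] := filter_ex (filterI uV uVC).
(* Every [y] is a limit: its neighbourhoods meet [B] in sets that meet all dense
   open sets. *)
move=> y By.
pose F : set_system X := [set A | exists W D,
  [/\ nbhs y W, open D, dense D & W `&` B `&` D `<=` A]].
have FF : ProperFilter F.
  apply: Build_ProperFilter_ex => [A [W [D [Wy oD dD]]]|].
    move: Wy; rewrite nbhsE => -[O [oO Oy] OW] WA.
    have [|x [[Ox Bx] Dx]] := dD (O `&` B) _ (openI oO oB).
      by have [x [Bx Ox]] := By _ (open_nbhs_nbhs (conj oO Oy)); exists x.
    by exists x; apply: WA; split=> //; split=> //; exact: OW.
  split.
  - exists setT, setT; split=> //; [exact: filterT|exact: openT|].
    by move=> O O0 _; rewrite setIT.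
  - move=> P Q [W [D [Wy oD dD WP]]] [W' [D' [Wy' oD' dD' WQ]]].
    exists (W `&` W'), (D `&` D'); split; [exact: filterI|exact: openI| |].
      exact: denseI.
    by move=> x [[[Wx Wx'] Bx] [Dx Dx']]; split; [apply: WP|apply: WQ].
  - move=> P Q PQ [W [D [Wy oD dD WP]]]; exists W, D; split=> //.
    exact: subset_trans PQ.
have [u [uU Fu]] := ultraFilterLemma FF.
have uZ : [/\ UltraFilter u, u B & forall D, open D -> dense D -> u D].
  split=> // [|D oD dD]; apply: Fu.
    exists setT, setT; split=> //; [exact: filterT|exact: openT| |].
      by move=> O O0 _; rewrite setIT.
    by move=> x [[]].
  by exists setT, D; split=> [|//|//|x []//]; exact: filterT.
exists (exist _ u uZ) => //; apply/fV => i /=.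
apply: Fu; exists (V y i), setT; split=> //.
- by apply: open_nbhs_nbhs; exact: oV.
- exact: openT.
- by move=> O O0 _; rewrite setIT.
- by move=> x [[]].
Qed.

(** * The closing-off argument *)

(** If all the [V x i] met [B], their traces on [B] would generate an open
    filter with a cluster point in the closure of [B], which could only be
    [x]. *)
Lemma separate_from_closure (K : choiceType) (X : topologicalType)
    (V : X -> K -> set X) (B : set X) (x : X) :
  (forall i, open_nbhs x (V x i)) ->
  \bigcap_i closure (V x i) = [set x] ->
  (forall i j, exists k, V x k `<=` V x i `&` V x j) ->
  open B -> open_filters_cluster B -> [set: K] !=set0 -> ~ closure B x ->
  exists i, V x i `&` B = set0.
Proof.
move=> oV clV dirV oB clusterB [i0 _] nBx; apply: contrapT => /forallNP VB.
have FF : ProperFilter (filter_from setT (fun i => V x i `&` B)).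
  apply: filter_from_proper; last by move=> i _; apply/set0P/eqP/VB.
  apply: filter_from_filter; first by exists i0.
  move=> i j _ _; have [k kij] := dirV i j; exists k => //.
  by move=> y [/kij[Vi Vj] By].
have [|y yP] := clusterB _ FF; first by exists i0 => // y [].
have yx : y = x.
  suff : [set x] y by [].
  rewrite -clV => i _; apply: yP; first exact: (oV i).1.
  by exists i => // z [].
by apply: nBx; rewrite -yx; apply: yP => //; exists i0 => // z [].
Qed.

(** A point [p] of [B] has a neighbourhood whose closure misses the boundary:
    otherwise the boundary, being compact, would contain a point in the closure
    of every neighbourhood of [p]. *)
Lemma compact_boundary_shrink (X : topologicalType) (B : set X) :
  hausdorff_space X -> open B -> B !=set0 -> compact (closure B `\` B) ->
  exists W, [/\ open W, W !=set0 & closure W `<=` B].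
Proof.
move=> hX oB [p Bp] cptB.
have [W [nW WB]] : exists W, nbhs p W /\ closure W `&` (closure B `\` B) = set0.
  apply: contrapT => /forallNP noW.
  have FF : ProperFilter (filter_from (nbhs p)
      (fun W => closure W `&` (closure B `\` B))).
    apply: filter_from_proper.
      apply: filter_from_filter; first by exists setT; exact: filterT.
      move=> W W' nW nW'; exists (W `&` W'); first exact: filterI.
      by move=> x [/closureI[Wx W'x] bx].
    by move=> W nW; apply/set0P/eqP => E; apply: (noW W).
  have [|q [[_ nBq] clq]] := cptB _ FF.
    by exists setT => [|x []//]; exact: filterT.
  suff pq : p = q by apply: nBq; rewrite -pq.
  apply: hX => W W' nW nW'.
  have Wq : closure (closure W) q.
    move=> U nU.
    have [||x [[Wx _] Ux]] := clq (closure W `&` (closure B `\` B)) U.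
    - by exists W.
    - by [].
    - by exists x.
  exact: (@closed_closure _ W q Wq _ nW').
exists (W° `&` B); split.
- by apply: openI => //; exact: open_interior.
- by exists p.
- move=> x Wx; apply: contrapT => nBx.
  suff : set0 x by []. 
  rewrite -WB; split; first by apply: closureS Wx => y [/interior_subset].
  by split=> //; apply: closureS Wx => y [].
Qed.

(** Finite intersections are again indexed by [K], because there are no more
    finite sequences in [K] than elements of [K]. *)
Lemma closed_pseudocharacter_nbhs (X : topologicalType) (K : choiceType) :
  infinite_set [set: K] -> closed_pseudocharacter_le X K ->
  exists V : X -> K -> set X,
    [/\ forall x i, open_nbhs x (V x i),
        forall x, \bigcap_i closure (V x i) = [set x] &
        forall x i j, exists k, V x k `<=` V x i `&` V x j].
Proof.
move=> infK psiK.
have [q qP] := card_le_rangeP [::] (card_seq_le infK).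
suff /choice[V VP] : forall x : X, exists V : K -> set X,
    [/\ forall i, open_nbhs x (V i), \bigcap_i closure (V i) = [set x] &
        forall i j, exists k, V k `<=` V i `&` V j].
  by exists V; split=> x; have [] := VP x.
move=> x; have [VV [oV VK Vx]] := psiK x.
have [e eP] := card_le_rangeP setT VK.
(* The default [setT] is harmless: if [VV] is empty then [x] is the only point. *)
pose U i := if pselect (VV (e i)) then e i else setT.
have oU i : open_nbhs x (U i).
  by rewrite /U; case: pselect => [/oV//|nV]; split=> //; exact: openT.
pose V k := [set y | forall i, i \in q k -> U i y].
exists V; split.
- move=> k; split; last by move=> i _; exact: (oU i).2.
  rewrite /V; elim: (q k) => [|i s IH].
    rewrite (_ : [set _ | _] = setT); first exact: openT.
    by apply/seteqP; split.
  rewrite (_ : [set _ | _] = U i `&` [set y | forall i, i \in s -> U i y]).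
    by apply: openI; [exact: (oU i).1|].
  apply/seteqP; split=> y yU.
    by split=> [|l ls]; apply: yU; rewrite inE ?eqxx // ls orbT.
  by move=> l; rewrite inE => /predU1P[->|]; [exact: yU.1|exact: yU.2].
- apply/seteqP; split=> [y yV|_ -> k _]; last first.
    by apply: subset_closure => i _; exact: (oU i).2.
  rewrite -Vx => A VA; have [i _ eA] := eP A VA.
  have [k _ qk] := qP [:: i] I.
  apply: closureS (yV k I) => z /(_ i); rewrite qk mem_head /U eA => /(_ isT).
  by case: pselect.
- move=> i j; have [k _ qk] := qP (q i ++ q j) I.
  exists k => y Vy; split=> l lq; apply: Vy; rewrite qk mem_cat lq ?orbT //.
Qed.

Theorem card_le_power_of_invariants (X : topologicalType) (K : choiceType) :
  hausdorff_space X -> infinite_set [set: K] ->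
  wL_le X K -> tightness_le X K -> closed_pseudocharacter_le X K ->
  (exists B : set (set X), [/\ pi_base B,
     forall A, B A -> open_filters_cluster A &
     forall A, B A -> compact (closure A `\` A)]) ->
  [set: X] #<= [set: K -> bool].
Proof.
move=> hX infK wLK tK psiK [B [[Bne Bpi] Bcluster Bcpt]].
have [V [oV clV dirV]] := closed_pseudocharacter_nbhs infK psiK.
have [[t0]|noX] := pselect (inhabited X); last first.
  suff -> : [set: X] = set0 by exact: card_ge0.
  by rewrite -subset0 => x _; apply: noX; exists.
have exN (U : set X) : exists A,
    ((exists2 A, B A & A `&` U = set0) -> B A /\ A `&` U = set0) /\
    A #<= [set: K -> bool].
  have [[A BA AU]|nA] := pselect (exists2 A, B A & A `&` U = set0).
    exists A; split=> //; have [oA _] := Bne _ BA.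
    apply: card_le_trans (subset_card_le (@subset_closure _ A)) _.
    exact: card_closure_le_power (Bcluster A BA).
  by exists set0; split.
(* [N U] is an element of the pi-base disjoint from [U], if there is one. *)
pose N U := sval (cid (exN U)).
have NP U A : B A -> A `&` U = set0 -> B (N U) /\ N U `&` U = set0.
  by move=> BA AU; apply: (svalP (cid (exN U))).1; exists A.
(* The first kind of operation reads the neighbourhoods [V (a (k, k)) (i k)] off
   the diagonal of the array [a], the mask [m] allowing for fewer than [K] of
   them; the second gives the point determined by the rows of [a]. *)
pose Phi (l : option ((K -> K) * (K -> bool))) (a : K * K -> X) : set X :=
  if l is Some (i, m) then N (\bigcup_(k in [set k | m k]) V (a (k, k)) (i k))
  else [set x | \bigcap_i closure (range (fun j => a (i, j))) = [set x]].
have [||||H [Ht0 HPhi HK]] :=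
  @closing_off K (K * K) _ (K -> bool) X Phi t0 infK.
- exact: card_square_le.
- apply/(card_option_le_power infK)/(card_prod_le_power infK) => //.
  exact: card_fun_le_power (card_le_power K).
- by [].
- move=> [[i m]|] a /=; first exact: (svalP (cid (exN _))).2.
  apply: (@card_le_range _ _ (fun=> xget t0 [set x |
    \bigcap_i closure (range (fun j => a (i, j))) = [set x]])) => y ay.
  exists xpredT => //; case: xgetP => [x _ ax|/(_ y)//].
  suff : [set y] x by [].
  by rewrite -[[set y]]ay ax.
(* The row [i] of the array enumerates a set of points of [H] in [V x i] that has
   [x] in its closure. *)
have clH : closed H.
  move=> x Hx.
  have /(_ _)/cid2 a i : exists2 a : K -> X, (forall j, (H `&` V x i) (a j)) &
      closure (range a) x.
    have [|C [CHV CK Cx]] := tK (H `&` V x i) x.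
      move=> W nW; have [|y [Hy [Vy Wy]]] := Hx (V x i `&` W).
        by apply: filterI nW; apply: open_nbhs_nbhs.
      by exists y.
    have [y [Cy _]] := Cx _ filterT.
    have [e eP] := card_le_rangeP y CK.
    exists (fun j => if pselect (C (e j)) then e j else y).
      by move=> j; case: pselect => [/CHV//|nC]; exact: CHV.
    suff -> : range (fun j => if pselect (C (e j)) then e j else y) = C by [].
    apply/seteqP; split=> [_ [j _ <-]|z Cz]; first by case: pselect.
    by have [j _ jz] := eP _ Cz; exists j => //; rewrite jz; case: pselect.
  apply: (HPhi None (fun ij => s2val (a ij.1) ij.2)).
    by move=> [i j]; have [] := s2valP (a i) j.
  apply/seteqP; split=> [y ya|_ -> i _]; last exact: (s2valP' (a i)).
  rewrite -clV => i _; apply: closureS (ya i I) => _ [j _ <-].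
  by have [] := s2valP (a i) j.
pose G := closure (\bigcup_(A in [set A | B A /\ A `<=` H]) A).
have GH : G `<=` H.
  apply: subset_trans clH; apply: closureS => x [A [_ AH] Ax]; exact: AH.
suff GT : G = setT.
  by apply: card_le_trans HK; rewrite -GT; exact: subset_card_le.
apply: contrapT => /eqP/setTPn[y nGy].
have oG : open (~` G) by apply: closed_openC; exact: closed_closure.
have [A BA AG] := Bpi _ oG (ex_intro _ y nGy).
have [oA A0] := Bne _ BA.
have [W [oW W0 WA]] := compact_boundary_shrink hX oA A0 (Bcpt _ BA).
have [C BC CW] := Bpi _ oW W0.
have [oC C0] := Bne _ BC.
have GC x : G x -> exists i, V x i `&` C = set0.
  move=> Gx; apply: separate_from_closure => //.
    exact: Bcluster.
    exact: infinite_setN0.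
  by move=> /(closureS CW)/WA/AG.
pose U := [set E | exists x i, [/\ G x, V x i `&` C = set0 & E = V x i]] `|`
  [set ~` G].
have [||S [SU SK Scl]] := wLK U.
- by move=> _ [[x [i [_ _ ->]]]|->] //; exact: (oV x i).1.
- apply/seteqP; split=> // x _; have [Gx|nGx] := pselect (G x).
    have [i VC] := GC x Gx; exists (V x i); last exact: (oV x i).2.
    by left; exists x, i.
  by exists (~` G) => //; right.
have [e eP] := card_le_rangeP set0 SK.
(* [good k x i] says that the [k]-th set of the dense subfamily is a chosen
   neighbourhood of the point [x] of [G]; the junk values of [xi] at the other
   indices are masked by [m]. *)
pose good k x i := [/\ G x, V x i `&` C = set0 & e k = V x i].
have /choice[xi xiP] k : exists xi : X * K, H xi.1 /\
    ((exists x i, good k x i) -> good k xi.1 xi.2).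
  have [[x [i h]]|nh] := pselect (exists x i, good k x i).
    by exists (x, i); split=> // ; apply: GH; case: h.
  by exists (t0, k).
pose m k := `[< exists x i, good k x i >].
pose O := \bigcup_(k in [set k | m k]) V (xi k).1 (xi k).2.
have OC : C `&` O = set0.
  rewrite -subset0 => x [Cx [k /asboolP /((xiP k).2) [_ VC _] Vx]].
  by rewrite -VC.
have [BN NO] := NP _ _ BC OC.
have NH : N O `<=` H.
  apply: (HPhi (Some (fun k => (xi k).2, m)) (fun kk => (xi kk.1).1)).
  by move=> [k k']; exact: (xiP k).1.
have [oN [z Nz]] := Bne _ BN.
have : closure (\bigcup_(E in S) E) z by rewrite Scl.
move=> /(_ (N O) (open_nbhs_nbhs (conj oN Nz)))[x [[E SE Ex] Nx]].
have [[v [i [Gv VC EV]]]|EG] := SU E SE; last first.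
  have : (~` G) x by rewrite -EG.
  by apply; apply: subset_closure; exists (N O).
have [k _ ek] := eP E SE.
have mk : exists x i, good k x i by exists v, i; split=> //; rewrite ek.
suff : set0 x by [].
rewrite -NO; split=> //; exists k; first exact/asboolP.
by have [_ _ <-] := (xiP k).2 mk; rewrite ek.
Qed.

(** * Finite invariants *)

Lemma card_le_empty_set0 (T U : Type) (A : set T) :
  ~ inhabited U -> A #<= [set: U] -> A = set0.
Proof.
move=> noU; have -> : [set: U] = set0.
  by rewrite -subset0 => u _; apply: noU; exists.
by move/card_le0P.
Qed.

(** Points are isolated, as finitely many of their neighbourhoods have no other
    point in common; hence a subfamily of the cover by singletons with a dense
    union contains every singleton. *)
Lemma card_le_weakly_lindelof_of_finite_psi (X : topologicalType) (K L : Type) :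
  finite_set [set: K] -> closed_pseudocharacter_le X K -> wL_le X L ->
  [set: X] #<= [set: L].
Proof.
move=> finK psiK wLL.
have nbhs1 (x : X) : nbhs x [set x].
  have [V [oV VK Vx]] := psiK x.
  have /finite_fsetP[D VD] : finite_set V := card_le_finite VK finK.
  have : nbhs x (\bigcap_(A in V) id A).
    rewrite VD; apply: filter_bigI => A AD; have /oV[oA Ax] : V A by rewrite VD.
    exact: open_nbhs_nbhs.
  apply: filterS => y Vy.
  by rewrite -Vx => A VA; apply: subset_closure; exact: Vy.
have [||S [SU SL Scl]] := wLL (range set1).
- by move=> _ [x _ <-]; rewrite openE => _ ->; exact: nbhs1.
- by apply/seteqP; split=> // x _; exists [set x] => //; exists x.
apply: card_le_trans SL.
have set1_inj : {in [set: X] &, injective (@set1 X)}.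
  by move=> x y _ _ xy; have : [set x] x by []; rewrite xy.
rewrite -(card_le_eql (inj_card_eq set1_inj)).
apply: subset_card_le => _ [x _ <-].
have : closure (\bigcup_(A in S) A) x by rewrite Scl.
move=> /(_ _ (nbhs1 x))[z [[A SA +] zx]]; rewrite zx.
by have [y _ yA] := SU A SA; move: SA; rewrite -yA => SA ->.
Qed.

Theorem corollary3p8 (X : topologicalType) (hX : hausdorff_space X)
    (hB : exists B : set (set X),
      [/\ pi_base B,
          forall A, B A -> H_closed (set_type (closure A)) &
          forall A, B A -> compact (closure A `\` A)]) :
  [set: X] #<= [set: (wL X * tightness X * closed_pseudocharacter X)%type -> bool].
Proof.
have [wLX _] := wLP X; have [tX _] := tightnessP X.
have [psiX _] := closed_pseudocharacterP hX.
set M := (wL X * tightness X * closed_pseudocharacter X)%type.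
(* An infinite product has three inhabited factors, so it bounds each of them. *)
have [infM|finM] := pselect (infinite_set [set: M]).
  have [[[w0 t0] p0] _] := infinite_setN0 infM.
  have wM : [set: wL X] #<= [set: M].
    by apply/card_le_injP; exists (fun w => (w, t0, p0)) => w w' [].
  have tM : [set: tightness X] #<= [set: M].
    by apply/card_le_injP; exists (fun t => (w0, t, p0)) => t t' [].
  have pM : [set: closed_pseudocharacter X] #<= [set: M].
    by apply/card_le_injP; exists (fun p => (w0, t0, p)) => p p' [].
  apply: (@card_le_power_of_invariants X {classic M}) => //.
  - move=> U oU covU; have [S [SU SK Scl]] := wLX U oU covU.
    by exists S; split=> //; exact: card_le_trans SK wM.
  - move=> A x Ax; have [S [SA SK Sx]] := tX A x Ax.
    by exists S; split=> //; exact: card_le_trans SK tM.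
  - move=> x; have [S [oS SK Sx]] := psiX x.
    by exists S; split=> //; exact: card_le_trans SK pM.
  - have [B [pB HB cB]] := hB; exists B; split=> // A BA.
    exact/H_closed_open_filters_cluster/HB.
have [sub1|] := pselect (forall x y : X, x = y).
  by apply/card_le_injP; exists (fun _ _ => false) => x y _; exact: sub1.
move=> /existsNP[x /existsNP[y xy]].
(* With two points, none of the invariants is zero, so a finite product has
   finite factors. *)
have [[w0]|noW] := pselect (inhabited (wL X)); last first.
  have [||S [_ /(card_le_empty_set0 noW) -> Scl]] := wLX [set setT].
  - by move=> _ ->; exact: openT.
  - by rewrite bigcup_set1.
  - rewrite bigcup_set0 closure0 in Scl.
    by have : [set: X] x by []; rewrite -Scl.
have [[t0]|noT] := pselect (inhabited (tightness X)); last first.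
  have [|S [_ /(card_le_empty_set0 noT) ->]] := tX [set x] x.
    exact: subset_closure.
  by rewrite closure0.
have [[p0]|noP] := pselect (inhabited (closed_pseudocharacter X)); last first.
  have [S [_ /(card_le_empty_set0 noP) ->]] := psiX x.
  rewrite bigcap_set0 => Tx; have : [set: X] y by [].
  by rewrite Tx => yx; case: xy.
have finP : finite_set [set: closed_pseudocharacter X].
  apply: contrapT => /infiniteP infP; apply: finM; apply/infiniteP.
  apply: card_le_trans infP _.
  by apply/card_le_injP; exists (fun p => (w0, t0, p)) => p p' [].
apply: card_le_trans (card_le_weakly_lindelof_of_finite_psi finP psiX wLX) _.
apply: card_le_trans (card_le_power M).
by apply/card_le_injP; exists (fun w => (w, t0, p0)) => w w' [].
Qed.
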